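(* Let $w\in\mathbb{C}$ with $|w|=1$, let $m\in\mathbb{N}$, let $\varphi$ be an analytic self-map of $\mathbb{D}$, and let $\psi\in H(\mathbb{D})$ be not identically zero, such that $D_{m,\psi,\varphi}$ is bounded and $J_w$-symmetric on $H^2(\beta)$. Then $D_{m,\psi,\varphi}$ is Hermitian (i.e. $D_{m,\psi,\varphi}=D_{m,\psi,\varphi}^*$) if and only if $$\psi^{(m)}(0)\in\mathbb{R},\quad \varphi'(0)\in\mathbb{R}\quad\text{and}\quad \overline{\varphi(0)}=\bar w\,\varphi(0).$$
   Context: $\mathbb{N}=\{0,1,2,\dots\}$. $\mathbb{D}$ is the open unit disc in $\mathbb{C}$ and $H(\mathbb{D})$ is the space of analytic functions on $\mathbb{D}$. $\{\beta(n)\}_{n\ge 0}$ is a sequence of positive numbers with $\beta(0)=1$ and $\liminf_{n}\beta(n)^{1/n}\ge 1$. The weighted Hardy space $H^2(\beta)$ is the Hilbert space of all $f(z)=\sum_{n\ge0}a_nz^n\in H(\mathbb{D})$ with $\|f\|^2=\sum_{n\ge 0}|a_n|^2\beta(n)^2<\infty$, with inner product $\langle f,g\rangle=\sum_{n\ge 0}a_n\overline{c_n}\beta(n)^2$ for $g(z)=\sum_{n\ge 0}c_nz^n$. For $m\in\mathbb{N}$, $\psi\in H(\mathbb{D})$ and an analytic self-map $\varphi$ of $\mathbb{D}$, the generalized weighted composition operator is $D_{m,\psi,\varphi}f(z)=\psi(z)f^{(m)}(\varphi(z))$. For $w\in\mathbb{C}$ with $|w|=1$, the conjugation $J_w$ on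 $H^2(\beta)$ (conjugate-linear, isometric, $J_w^2=I$) is $J_wf(z)=\overline{f(w\bar z)}$. A bounded linear operator $T$ on $H^2(\beta)$ is $J_w$-symmetric if $T=J_wT^*J_w$. *)

(* Defs.v *)
From HB Require Import structures.
From mathcomp Require Import all_boot all_order all_algebra.
From mathcomp Require Import complex.
From mathcomp Require Import all_classical all_reals all_analysis.

Set Implicit Arguments.
Unset Strict Implicit.
Unset Printing Implicit Defensive.

Import Order.TTheory GRing.Theory Num.Theory.
Import numFieldNormedType.Exports.

Local Open Scope ring_scope.
Local Open Scope classical_set_scope.

(* R[i] packaged as a numClosedFieldType, so that the topology and norm of a
   numFieldType over itself are found by inference; derivable and derive1n are
   then complex differentiability and iterated complex derivatives. *)
Definition Cplx (R : realType) : numClosedFieldType := R[i].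

Definition ofR (R : realType) (x : R) : Cplx R := real_complex R x.

(* In R[i] the norm is itself complex-valued; absC z is |z| as an element of R. *)
Definition absC (R : realType) (z : Cplx R) : R := complex.Re `|z|.

Definition unit_disc (R : realType) : set (Cplx R) := [set z | `|z| < 1].

(* Functions on the disc are represented by total functions on C whose values
   off the disc are irrelevant: they are compared with eq_disc only. *)
Definition eq_disc (R : realType) (f g : Cplx R -> Cplx R) : Prop :=
  forall z, unit_disc z -> f z = g z.

Definition holomorphic (R : realType) (f : Cplx R -> Cplx R) : Prop :=
  forall z, unit_disc z -> derivable f z 1.

Definition analytic_self_map (R : realType) (f : Cplx R -> Cplx R) : Prop :=
  holomorphic f /\ forall z, unit_disc z -> unit_disc (f z).

Definition taylor_coef (R : realType) (f : Cplx R -> Cplx R) (n : nat) :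
  Cplx R := derive1n n f 0 / n`!%:R.

(* At n = 0 the exponent is 0^-1 = 0; this does not affect the liminf. *)
Definition weight (R : realType) (beta : nat -> R) : Prop :=
  [/\ forall n, 0 < beta n,
      beta 0%N = 1
    & (1%:E <= limn_einf (fun n : nat => (beta n `^ (n%:R^-1))%:E))%E].

Section WeightedHardy.
Variables (R : realType) (beta : nat -> R).
Local Notation C := (Cplx R).

Definition sqnormH2 (f : C -> C) : \bar R :=
  (\sum_(0 <= n <oo) (absC (taylor_coef f n) ^+ 2 * beta n ^+ 2)%:E)%E.

Definition normH2 (f : C -> C) : R := Num.sqrt (fine (sqnormH2 f)).

(* Taylor's theorem for holomorphic functions is not in the library, so the
   expansion f(z) = sum_n a_n z^n on the disc is part of the definition. *)
Definition H2 (f : C -> C) : Prop :=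
  [/\ holomorphic f,
      forall z, unit_disc z ->
        series (fun n : nat => taylor_coef f n * z ^+ n : C) n @[n --> \oo]
          --> f z
    & (sqnormH2 f < +oo)%E].

Definition innerH2 (f g : C -> C) : C :=
  limn (series (fun n : nat =>
    taylor_coef f n * (taylor_coef g n)^* * ofR (beta n) ^+ 2 : C)).

Definition eq_op_H2 (T S : (C -> C) -> (C -> C)) : Prop :=
  forall f, H2 f -> eq_disc (T f) (S f).

Definition bounded_operator (T : (C -> C) -> (C -> C)) : Prop :=
  [/\ forall f, H2 f -> H2 (T f),
      forall (a : C) f g, H2 f -> H2 g ->
        eq_disc (T (fun z => a * f z + g z)) (fun z => a * T f z + T g z)
    & exists M : R, forall f, H2 f -> normH2 (T f) <= M * normH2 f].

(* S is the adjoint of T; being determined up to eq_op_H2 by T, it is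
   handled through this relation instead of a chosen value. *)
Definition is_adjoint (T S : (C -> C) -> (C -> C)) : Prop :=
  bounded_operator S /\
  forall f g, H2 f -> H2 g -> innerH2 (T f) g = innerH2 f (S g).

Definition conjugation (w : C) (f : C -> C) : C -> C :=
  fun z => (f (w * z^*))^*.

Definition J_symmetric (w : C) (T : (C -> C) -> (C -> C)) : Prop :=
  exists S, is_adjoint T S /\
    eq_op_H2 T (fun f => conjugation w (S (conjugation w f))).

Definition hermitian_operator (T : (C -> C) -> (C -> C)) : Prop :=
  exists S, is_adjoint T S /\ eq_op_H2 T S.

End WeightedHardy.

Definition gen_wcomp (R : realType) (m : nat) (psi phi : Cplx R -> Cplx R)
    (f : Cplx R -> Cplx R) : Cplx R -> Cplx R :=
  fun z => psi z * derive1n m f (phi z).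

(* Main.v *)
(* Write P_l = psi * phi^l. Each P_l is a multiple of the image of z^(m+l), so it
   lies in H^2(beta) and equals its Taylor series on the disc. Comparing the
   matrix of T = D_{m,psi,phi} with that of T* = J_w T J_w shows that P_l vanishes
   to order m at 0 and relates the coefficient m+l of P_k to the coefficient m+k
   of P_l. Let q_(l,i) be the coefficient m+i of P_l: dividing P_l = P_0 * phi^l
   by z^m and letting z -> 0 gives q_(l,0) = q_(0,0) phi(0)^l and q_(l,1) in terms
   of q_(0,0), q_(0,1), phi(0) and phi'(0), with q_(0,0) <> 0. If T is Hermitian,
   the entries (m,m), (m,m+1), (m+1,m+1) of its matrix give the three conditions.
   Conversely, the conditions and the columns k = 0, 1 of the matrix yield
   conj(P_l(w conj z)) = conj(w)^(m+l) P_l(z) for l = 0, 1. These two equations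
   give the same one for every l, because they determine conj(phi(w conj z))
   where psi(z) <> 0 and P_l vanishes where psi does. Hence T and T* agree on
   monomials, and so, by the adjoint relation, on all Taylor coefficients. *)
Require Import Defs.
From HB Require Import structures.
From mathcomp Require Import all_boot all_order all_algebra.
From mathcomp Require Import complex.
From mathcomp Require Import all_classical all_reals all_analysis.
From mathcomp Require Import ring.
Import Order.TTheory GRing.Theory Num.Theory.
Import numFieldNormedType.Exports.
Local Open Scope ring_scope.
Local Open Scope classical_set_scope.

(** * Power series expansions on the punctured disc *)

(* Evaluation at 0 is excluded so that [F z / z], which is 0 at [z = 0] in Rocq,
   can be expanded too. *)
Definition expands_off0 {R : realType} (F : Cplx R -> Cplx R) (a : nat -> Cplx R) :=
  forall z, unit_disc z -> z != 0 ->
    series (fun n => a n * z ^+ n : Cplx R) n @[n --> \oo] --> F z.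

Lemma expands_off0_shift {R : realType} (F : Cplx R -> Cplx R) (a : nat -> Cplx R) :
  expands_off0 F a ->
  expands_off0 (fun z => (F z - a 0%N) / z) (fun n => a n.+1).
Proof.
move=> Fa z zD z0.
have -> : series (fun n => a n.+1 * z ^+ n : Cplx R) =
    (fun n => (series (fun n => a n * z ^+ n : Cplx R) n.+1 - a 0%N) * z^-1).
  apply/funext => n; rewrite /series /= big_nat_recl// expr0 mulr1 addrAC subrr add0r.
  by rewrite mulr_suml; apply: eq_bigr => i _; rewrite exprSr mulrA mulfK.
apply: cvgMr_tmp; apply: cvgB; last exact: cvg_cst.
move: (Fa z zD z0).
by rewrite -(cvg_shiftS (series (fun n => a n * z ^+ n : Cplx R))).
Qed.

(** Convergence at 1/2 bounds |a_n| by M 2^n, so for |z| <= 1/4 the series is dominated by the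
    geometric series of terms M 2^-n. *)
Lemma expands_off0_bounded {R : realType} (F : Cplx R -> Cplx R) (a : nat -> Cplx R) :
  expands_off0 F a ->
  exists M : Cplx R, forall z, z != 0 -> `|z| <= 4^-1 -> `|F z| <= M.
Proof.
move=> Fa.
have h0 : (2^-1 : Cplx R) != 0 by rewrite invr_neq0// pnatr_eq0.
have hD : unit_disc (2^-1 : Cplx R).
  by rewrite /unit_disc /= ger0_norm ?invr_ge0// invf_lt1// ltr1n.
have := Fa _ hD h0 => /cvgP /cvg_series_cvg_0 /cvgP /cvg_seq_bounded.
case=> M' [M'real /(_ (M' + 1))]; set M := M' + 1; rewrite ltrDl ltr01 => /(_ isT) aM.
have {}aM n : `|a n| <= M * 2 ^+ n.
  have := aM n I; rewrite /= normrM normrX [`|2^-1|]gtr0_norm ?invr_gt0//.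
  by rewrite exprVn -ler_pdivlMr ?invr_gt0 ?exprn_gt0// invrK.
have M0 : 0 <= M by have := aM 0%N; rewrite expr0 mulr1; exact: le_trans.
exists (2 * M + 1) => z z0 z4.
have zD : unit_disc z.
  by apply: le_lt_trans z4 _; rewrite invf_lt1// ltr1n.
have sM n : `|series (fun n => a n * z ^+ n : Cplx R) n| <= 2 * M * (1 - 2^-1 ^+ n).
  elim: n => [|n IH].
    by rewrite /series /= big_geq// normr0 expr0 subrr mulr0.
  rewrite /series /= big_nat_recr//=.
  have -> : 2 * M * (1 - 2^-1 ^+ n.+1) = 2 * M * (1 - 2^-1 ^+ n) + M * 2^-1 ^+ n.
    by rewrite exprS; field.
  apply: le_trans (ler_normD _ _) (lerD IH _).
  rewrite normrM normrX.
  apply: (@le_trans _ _ ((M * 2 ^+ n) * (4^-1) ^+ n)).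
    apply: ler_pM; [exact: normr_ge0|exact/exprn_ge0/normr_ge0|exact: aM|].
    by apply: lerXn2r; rewrite ?nnegrE ?invr_ge0.
  have -> : M * 2 ^+ n * 4^-1 ^+ n = M * (2 * 4^-1) ^+ n by rewrite exprMn mulrA.
  by have -> : (2 * 4^-1 : Cplx R) = 2^-1 by field.
(* The summand 1 in the bound 2M + 1 is the distance from [F z] to a late partial sum. *)
have := Fa _ zD z0 => /cvgrPdist_le /(_ 1 ltr01) [N _ /(_ N (leqnn N))] /= FN.
rewrite -(subrK (series (fun n => a n * z ^+ n : Cplx R) N) (F z)) addrC.
apply: le_trans (ler_normD _ _) (lerD (le_trans (sM N) _) FN).
rewrite ler_piMr ?mulr_ge0// gerBl exprn_ge0// invr_ge0//.
Qed.

(** [F z - a 0] is z times the shifted quotient, which stays bounded near 0. *)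
Lemma expands_off0_cvg0 {R : realType} (F : Cplx R -> Cplx R) (a : nat -> Cplx R) :
  expands_off0 F a -> F z @[z --> 0^'] --> a 0%N.
Proof.
move=> /expands_off0_shift/expands_off0_bounded[M FM].
have M0 : 0 <= M.
  apply: le_trans (FM 4^-1 _ _); first exact: normr_ge0.
    by rewrite invr_neq0// pnatr_eq0.
  by rewrite ger0_norm// invr_ge0.
apply/cvgrPdist_le => e e0; near=> z.
have z0 : z != 0 by near: z; exact: nbhs_dnbhs_neq.
have z4 : `|z| < 4^-1 by near: z; apply: dnbhs0_lt; rewrite invr_gt0.
(* [M + 1] rather than [M], which may be 0. *)
have ze : `|z| < e / (M + 1).
  by near: z; apply: dnbhs0_lt; rewrite divr_gt0// ltr_wpDl.
rewrite distrC -(divfK z0 (F z - a 0%N)) normrM.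
apply: (@le_trans _ _ (M * (e / (M + 1)))).
  by apply: ler_pM => //; [exact/FM/ltW|exact: ltW].
rewrite mulrA ler_pdivrMr ?ltr_wpDl// mulrC ler_pM2l// lerDl//.
Unshelve. all: by end_near. Qed.

(** The constant term is the limit at 0. Once these agree, both shifted sequences expand the same
    quotient, so the induction has to quantify over [F]. *)
Lemma expands_off0_inj {R : realType} (F : Cplx R -> Cplx R) (a b : nat -> Cplx R) :
  expands_off0 F a -> expands_off0 F b -> a =1 b.
Proof.
move=> Fa Fb n; elim: n => [|n IH] in F a b Fa Fb *.
  exact: (cvg_unique (@norm_hausdorff _ _) (expands_off0_cvg0 _ _ Fa) (expands_off0_cvg0 _ _ Fb)).
have ab0 : a 0%N = b 0%N.
  exact: (cvg_unique (@norm_hausdorff _ _) (expands_off0_cvg0 _ _ Fa) (expands_off0_cvg0 _ _ Fb)).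
apply: (IH (fun z => (F z - a 0%N) / z) (fun n => a n.+1) (fun n => b n.+1)).
  exact: expands_off0_shift.
by rewrite ab0; exact: expands_off0_shift.
Qed.

Lemma expands_off0_drop {R : realType} (F : Cplx R -> Cplx R) (a : nat -> Cplx R) (m : nat) :
  expands_off0 F a -> (forall j, (j < m)%N -> a j = 0) ->
  expands_off0 (fun z => F z / z ^+ m) (fun n => a (m + n)%N).
Proof.
move=> Fa; elim: m => [|m IH] am0.
  by move=> z zD z0; rewrite expr0 divr1; exact: Fa.
have /expands_off0_shift := IH (fun j jm => am0 j (ltnW jm)).
have am : a (m + 0)%N = 0 by apply: am0; rewrite addn0.
move=> H z zD z0.
have -> : (fun n => a (m.+1 + n)%N * z ^+ n : Cplx R) = (fun n => a (m + n.+1)%N * z ^+ n).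
  by apply/funext => n; rewrite addnS.
have -> : F z / z ^+ m.+1 = (F z / z ^+ m - a (m + 0)%N) / z
  by rewrite am subr0 exprSr invfM mulrA.
exact: H.
Qed.

(** * Real scalars and conjugation of limits *)

Lemma ofR_real {R : realType} (x : R) : ofR x \is Num.real.
Proof. by apply/complex_realP; exists x. Qed.

Lemma ofR_gt0 {R : realType} (x : R) : 0 < x -> 0 < ofR x.
Proof. by rewrite -(ltcR 0 x). Qed.

Lemma cvg_conj {R : realType} {T : Type} {F : set_system T} {FF : Filter F}
    (u : T -> Cplx R) (l : Cplx R) :
  u x @[x --> F] --> l -> (u x)^* @[x --> F] --> l^*.
Proof.
move=> /cvgrPdist_le ul; apply/cvgrPdist_le => e /ul; apply: filterS => x.
by rewrite -rmorphB norm_conjC.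
Qed.

(* A divergent sequence has the junk limit [point], which is 0 here, hence is also real. *)
Lemma limn_conj {R : realType} (u : nat -> Cplx R) :
  limn (fun n => (u n)^*) = (limn u)^*.
Proof.
have [uc|ud] := pselect (cvgn u).
  by apply: cvg_lim; [exact: norm_hausdorff|exact: cvg_conj].
have -> : limn u = 0 := dvgP ud.
rewrite conjC0; apply: (@dvgP (Cplx R)) => /cvg_ex[l ul]; apply: ud; apply/cvg_ex.
have uE : (fun n => (u n)^*^*) = u by apply/funext => n; rewrite conjCK.
by exists l^*; rewrite -uE; exact: cvg_conj.
Qed.

(** * One-term series and monomials *)

Lemma series1 {V : nmodType} (u : nat -> V) (n N : nat) :
  (forall j, j != n -> u j = 0) -> (n < N)%N -> \sum_(0 <= j < N) u j = u n.
Proof.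
move=> u0 nN; rewrite (bigD1_seq n) ?mem_index_iota ?iota_uniq//=.
by rewrite big1 ?addr0.
Qed.

Lemma cvg_series1 {R : realType} (u : nat -> Cplx R) (n : nat) :
  (forall j, j != n -> u j = 0) -> series u N @[N --> \oo] --> u n.
Proof.
move=> u0; apply: cvg_near_cst; exists n.+1 => // N /= nN.
exact: series1.
Qed.

(** The factor [c] makes the family stable under differentiation and under J_w. *)
Definition monomial {R : realType} (c : Cplx R) (n : nat) : Cplx R -> Cplx R :=
  fun z => c * z ^+ n.

Lemma derivable_monomial {R : realType} (c : Cplx R) n (z : Cplx R) :
  derivable (monomial c n) z 1.
Proof. by apply: derivableM; [exact: derivable_cst|exact: exprn_derivable]. Qed.

Lemma derive1_monomial {R : realType} (c : Cplx R) n :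
  derive1 (monomial c n) = monomial (c * n%:R) n.-1.
Proof.
apply/funext => z; rewrite derive1Ml; last exact: exprn_derivable.
by rewrite exp_derive1 /monomial -mulrA.
Qed.

Lemma derive1n_monomial {R : realType} (c : Cplx R) n j :
  derive1n j (monomial c n) = monomial (c * (n ^_ j)%:R) (n - j).
Proof.
elim: j => [|j IH]; first by rewrite derive1n0 ffactn0 mulr1 subn0.
by rewrite derive1nS IH derive1_monomial ffactnSr natrM mulrA subnS.
Qed.

Lemma taylor_coef_monomial {R : realType} (c : Cplx R) n j :
  taylor_coef (monomial c n) j = if j == n then c else 0.
Proof.
rewrite /taylor_coef derive1n_monomial /monomial; case: ltngtP => [jn|nj|->].
- by rewrite expr0n subn_eq0 leqNgt jn mulr0 mul0r.
- by rewrite ffact_small// mulr0 !mul0r.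
- by rewrite subnn expr0 mulr1 ffactnn mulfK// pnatr_eq0 -lt0n fact_gt0.
Qed.

(** * Taylor coefficients and inner products in H^2(beta) *)

Section WeightedHardyFacts.
Variables (R : realType) (beta : nat -> R).
Local Notation C := (Cplx R).
Implicit Types (f g : C -> C) (c : C).

Lemma H2_expands f : H2 beta f -> expands_off0 f (taylor_coef f).
Proof. by case=> _ fE _ z zD _; exact: fE. Qed.

Lemma taylor_coef_uniq f (a : nat -> C) : H2 beta f -> expands_off0 f a ->
  forall n, taylor_coef f n = a n.
Proof. by move=> /H2_expands; exact: expands_off0_inj. Qed.

Lemma eq_taylor_coef f g : H2 beta f -> H2 beta g ->
  (forall z, unit_disc z -> z != 0 -> f z = g z) ->
  taylor_coef f =1 taylor_coef g.
Proof.
move=> Hf /H2_expands gE fg; apply: (taylor_coef_uniq _ _ Hf) => z zD z0.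
rewrite (fg z zD z0); exact: gE.
Qed.

Lemma H2_eq_disc f g : H2 beta f -> H2 beta g ->
  taylor_coef f =1 taylor_coef g -> eq_disc f g.
Proof.
move=> [_ fE _] [_ gE _] /funext fg z zD.
by apply: cvg_unique (fE z zD) _; [exact: norm_hausdorff|rewrite fg; exact: gE].
Qed.

Lemma H2_monomial c n : H2 beta (monomial c n).
Proof.
split=> [z _|z _|]; first exact: derivable_monomial.
  have -> : monomial c n z = taylor_coef (monomial c n) n * z ^+ n.
    by rewrite taylor_coef_monomial eqxx.
  apply: (cvg_series1 (fun j => taylor_coef (monomial c n) j * z ^+ j : C)) => j jn.
  by rewrite taylor_coef_monomial (negbTE jn) mul0r.
have -> : sqnormH2 beta (monomial c n) = (absC c ^+ 2 * beta n ^+ 2)%:E; last exact: ltry.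
apply: lim_near_cst => //; exists n.+1 => // N /= nN.
rewrite (series1 _ n) ?taylor_coef_monomial ?eqxx// => j jn.
by rewrite taylor_coef_monomial (negbTE jn) /absC normr0 expr0n /= mul0r.
Qed.

(** Divergent series are covered as well, because [limn_conj] handles the junk limit. *)
Lemma innerH2_conj f g : innerH2 beta g f = (innerH2 beta f g)^*.
Proof.
rewrite /innerH2 -limn_conj; congr (limn _); apply/funext => N.
rewrite /series /= rmorph_sum; apply: eq_bigr => j _.
move: (taylor_coef f j) (taylor_coef g j) (ofR (beta j)) (ofR_real (beta j)).
move=> a b r /conj_Creal rr.
by rewrite expr2 !rmorphM /= conjCK rr [b * _]mulrC.
Qed.

(** Pairing with monomials reads off Taylor coefficients, which turns adjoint relations into matrix
    identities. *)
Lemma innerH2_monomial f c n :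
  innerH2 beta f (monomial c n) = taylor_coef f n * c^* * ofR (beta n) ^+ 2.
Proof.
have -> : c = taylor_coef (monomial c n) n by rewrite taylor_coef_monomial eqxx.
rewrite [in LHS]taylor_coef_monomial eqxx.
apply: cvg_lim; first exact: norm_hausdorff.
apply: (cvg_series1 (fun j => taylor_coef f j * (taylor_coef (monomial c n) j)^* *
  ofR (beta j) ^+ 2 : C)) => j jn.
by rewrite taylor_coef_monomial (negbTE jn) conjC0 mulr0 mul0r.
Qed.

Lemma eq_innerH2 f g g' : taylor_coef g =1 taylor_coef g' ->
  innerH2 beta f g = innerH2 beta f g'.
Proof. by rewrite /innerH2 => /funext ->. Qed.

End WeightedHardyFacts.

(** * Limits at 0 and the first two coefficients of a product *)

Lemma cvg_dnbhs0_eq_disc {R : realType} (F G : Cplx R -> Cplx R) (l : Cplx R) :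
  (forall z, unit_disc z -> z != 0 -> F z = G z) ->
  F z @[z --> 0^'] --> l -> G z @[z --> 0^'] --> l.
Proof.
move=> FG; apply: cvg_trans; apply: near_eq_cvg; near=> z; apply: FG.
  by near: z; exact: dnbhs0_lt.
by near: z; exact: nbhs_dnbhs_neq.
Unshelve. all: by end_near. Qed.

Lemma derivable_cvg0 {R : realType} (g : Cplx R -> Cplx R) :
  derivable g 0 1 -> (g z - g 0) / z @[z --> 0^'] --> derive1 g 0.
Proof.
rewrite derive1E => g0.
have H : h^-1 *: (g (h *: 1 + 0) - g 0) @[h --> (0 : Cplx R)^'] --> 'D_1 g 0 := g0.
apply: cvg_dnbhs0_eq_disc H => z _ _.
by rewrite addr0 /GRing.scale /= mulr1 mulrC.
Qed.

(** Only differentiability of [g] at 0 is available, so there is no Cauchy product: the two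
    coefficients of [G] are obtained as limits at 0 of [G z] and of [(G z - b 0) / z]. *)
Lemma expands_off0_mul {R : realType} {F G g : Cplx R -> Cplx R} {a b : nat -> Cplx R} :
  expands_off0 F a -> expands_off0 G b -> derivable g 0 1 ->
  (forall z, unit_disc z -> z != 0 -> G z = F z * g z) ->
  b 0%N = a 0%N * g 0 /\ b 1%N = a 1%N * g 0 + a 0%N * derive1 g 0.
Proof.
move=> Fa Gb dg GFg.
have gc : g z @[z --> 0^'] --> g 0.
  by apply/continuous_withinNx/differentiable_continuous/derivable1_diffP.
have b0 : b 0%N = a 0%N * g 0.
  apply: (cvg_unique (@norm_hausdorff _ _) (expands_off0_cvg0 _ _ Gb)).
  apply: (@cvg_dnbhs0_eq_disc _ (fun z => F z * g z)) => [z zD z0|].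
    by rewrite GFg.
  by apply: cvgM; [exact: expands_off0_cvg0 Fa|exact: gc].
split=> //.
apply: (cvg_unique (@norm_hausdorff _ _)
  (expands_off0_cvg0 _ _ (expands_off0_shift _ _ Gb))).
(* The quotient is split as in the proof of the product rule. *)
apply: (@cvg_dnbhs0_eq_disc _
    (fun z => (F z - a 0%N) / z * g z + a 0%N * ((g z - g 0) / z))) => [z zD z0|].
  by rewrite GFg// b0; field.
apply: cvgD; last by apply: cvgMl_tmp; exact: derivable_cvg0.
by apply: cvgM; [exact: (expands_off0_cvg0 _ _ (expands_off0_shift _ _ Fa))|exact: gc].
Qed.

Lemma derive1_exprn {R : realType} (g : Cplx R -> Cplx R) (z : Cplx R) l :
  derivable g z 1 ->
  derivable (fun u => g u ^+ l) z 1 /\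
  derive1 (fun u => g u ^+ l) z = l%:R * g z ^+ l.-1 * derive1 g z.
Proof.
move=> dg.
have -> : (fun u => g u ^+ l) = g ^+ l by apply/funext => u; rewrite fctE.
by split; [exact: derivableX|rewrite !derive1E deriveX].
Qed.

(** * The conjugation J_w on expansions *)

Section Conjugation.
Variables (R : realType) (w : Cplx R).
Hypothesis hw : `|w| = 1.

Lemma mul_conj1 : w * w^* = 1.
Proof. by rewrite -normCK hw expr1n. Qed.

Lemma unit_disc_conjugate (z : Cplx R) : unit_disc z -> unit_disc (w * z^*).
Proof. by rewrite /unit_disc /= normrM hw mul1r norm_conjC. Qed.

Lemma conjugate_conjugate (z : Cplx R) : w * (w * z^*)^* = z.
Proof. by rewrite rmorphM /= conjCK mulrA mul_conj1 mul1r. Qed.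

Lemma expands_off0_conjugation (F : Cplx R -> Cplx R) (a : nat -> Cplx R) :
  expands_off0 F a -> expands_off0 (conjugation w F) (fun n => (a n)^* * w^* ^+ n).
Proof.
move=> Fa z zD z0.
have wz0 : w * z^* != 0.
  by rewrite -normr_eq0 normrM hw mul1r norm_conjC normr_eq0.
have -> : series (fun n => (a n)^* * w^* ^+ n * z ^+ n : Cplx R) =
    (fun N => (series (fun n => a n * (w * z^*) ^+ n : Cplx R) N)^*).
  apply/funext => N; rewrite /series /= rmorph_sum; apply: eq_bigr => i _.
  by rewrite rmorphM rmorphXn /= rmorphM /= conjCK exprMn mulrA.
exact: cvg_conj (Fa _ (unit_disc_conjugate _ zD) wz0).
Qed.

End Conjugation.

Lemma expands_off0Z {R : realType} (c : Cplx R) (F : Cplx R -> Cplx R) (a : nat -> Cplx R) :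
  expands_off0 F a -> expands_off0 (fun z => c * F z) (fun n => c * a n).
Proof.
move=> Fa z zD z0.
have -> : series (fun n => c * a n * z ^+ n : Cplx R) =
    (fun n => c * series (fun n => a n * z ^+ n : Cplx R) n).
  apply/funext => N; rewrite /series /= mulr_sumr.
  by apply: eq_bigr => i _; rewrite mulrA.
by apply: cvgMl_tmp; exact: Fa.
Qed.

(** * Algebra of the matrix coefficients *)

(* In the next three lemmas f_l stands for (m+l)!/l!, b_l for beta(m+l)^2, q_(l,i)
   for the coefficient m+i of psi * phi^l, x for phi(0) and y for phi'(0). *)
Lemma hermitian_coefs_real {C : numClosedFieldType}
    {w f0 f1 b0 b1 q00 q01 q10 q11 x y : C} :
  w * w^* = 1 ->
  [/\ f0 \is Num.real, f1 \is Num.real, b0 \is Num.real & b1 \is Num.real] ->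
  [/\ f0 != 0, f1 != 0, b0 != 0 & b1 != 0] -> q00 != 0 ->
  q10 = q00 * x -> q11 = q01 * x + q00 * y ->
  f0 * q01 * b1 * w = f1 * q10 * b0 ->
  f0 * q00 * b0 = f0 * q00^* * b0 ->
  f0 * q01 * b1 = f1 * q10^* * b0 ->
  f1 * q11 * b1 = f1 * q11^* * b1 ->
  [/\ q00 \is Num.real, y \is Num.real & x^* = w^* * x].
Proof.
move=> ww [/conj_Creal cf0 /conj_Creal cf1 /conj_Creal cb0 /conj_Creal cb1].
move=> [nf0 nf1 nb0 nb1] nq q10E q11E s01 h00 h01 h11.
have r00 : q00^* = q00 by apply: (mulfI nf0); apply: (mulIf nb0); rewrite -h00.
have r11 : q11^* = q11 by apply: (mulfI nf1); apply: (mulIf nb1); rewrite -h11.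
(* The symmetry relation [s01] and the Hermitian relation [h01] have the same left side up to the
   factor [w]. *)
have r10 : q10^* * w = q10.
  by apply: (mulfI nf1); apply: (mulIf nb0); rewrite -s01 h01; ring.
have x0 : x^* * w = x.
  by apply: (mulfI nq); rewrite -q10E -[RHS]r10 q10E rmorphM /= r00; ring.
(* By [h01], [q01] is a real multiple of the conjugate of [q10 = q00 * x], so [q01 * x] is a real
   multiple of |x|^2. *)
have q01x : (q01 * x)^* = q01 * x.
  have h01' := congr1 Num.conj h01.
  rewrite !rmorphM /= conjCK cf0 cf1 cb0 cb1 in h01'.
  apply: (mulfI nf0); apply: (mulIf nb1); rewrite rmorphM /=.
  transitivity (f0 * q01^* * b1 * x^*); first by ring.
  transitivity (f0 * q01 * b1 * x); last by ring.
  by rewrite h01' h01 q10E rmorphM /= r00; ring.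
split; [exact/CrealP| |by rewrite -[in RHS]x0 mulrC -mulrA ww mulr1].
(* In the real number [q11 = q01 * x + q00 * y] the first term is real, hence so is [q00 * y]. *)
apply/CrealP; apply: (mulfI nq); move: r11.
by rewrite q11E rmorphD /= q01x rmorphM /= r00 => /addrI.
Qed.

Lemma conj_first_coef {C : numClosedFieldType} {w f0 fl b0 bl q00 q x : C} (l : nat) :
  w * w^* = 1 ->
  [/\ f0 \is Num.real, fl \is Num.real, b0 \is Num.real & bl \is Num.real] ->
  f0 != 0 -> bl != 0 -> q00 \is Num.real -> x^* = w^* * x ->
  f0 * q * bl * w ^+ l = fl * (q00 * x ^+ l) * b0 ->
  q^* = w ^+ l * q.
Proof.
move=> ww [/conj_Creal cf0 /conj_Creal cfl /conj_Creal cb0 /conj_Creal cbl].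
move=> nf0 nbl /conj_Creal cq cx qE.
have nw : w^* ^+ l != 0.
  rewrite expf_neq0//; apply: contraTneq isT => w0.
  by move: ww; rewrite w0 mulr0 => /esym/eqP; rewrite oner_eq0.
(* By [cx], conjugating [qE] multiplies its right side by conj(w)^l; comparing with [qE] itself
   gives the claim. *)
have qE' := congr1 Num.conj qE.
rewrite !rmorphM !rmorphXn /= cx cf0 cfl cb0 cbl cq exprMn in qE'.
apply: (mulfI nf0); apply: (mulIf nbl); apply: (mulIf nw); rewrite qE'.
transitivity (w^* ^+ l * (fl * (q00 * x ^+ l) * b0)); first by ring.
by rewrite -qE; ring.
Qed.

Lemma conj_second_coef {C : numClosedFieldType}
    {w f1 fl b1 bl q00 q01 q x y : C} (l : nat) :
  w * w^* = 1 ->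
  [/\ f1 \is Num.real, fl \is Num.real, b1 \is Num.real & bl \is Num.real] ->
  f1 != 0 -> bl != 0 -> q00 \is Num.real -> y \is Num.real ->
  x^* = w^* * x -> q01^* = w * q01 ->
  f1 * q * bl * w ^+ l = fl * (q01 * x ^+ l + q00 * (l%:R * x ^+ l.-1 * y)) * b1 * w ->
  q^* = w^* * w ^+ l * q.
Proof.
move=> ww [/conj_Creal cf1 /conj_Creal cfl /conj_Creal cb1 /conj_Creal cbl].
move=> nf1 nbl /conj_Creal cq /conj_Creal cy cx cq01 qE.
have nw : w^* ^+ l != 0.
  rewrite expf_neq0//; apply: contraTneq isT => w0.
  by move: ww; rewrite w0 mulr0 => /esym/eqP; rewrite oner_eq0.
have qE' := congr1 Num.conj qE.
rewrite !rmorphM !rmorphXn rmorphD /= !rmorphM !rmorphXn /= in qE'.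
rewrite cx cf1 cfl cb1 cbl cq cy cq01 conjC_nat !exprMn in qE'.
apply: (mulfI nf1); apply: (mulIf nbl); apply: (mulIf nw); rewrite qE'.
transitivity (w^* * w^* ^+ l * (f1 * q * bl * w ^+ l)); last by ring.
(* For l = 0 the factor [l%:R] kills the term with [l.-1]; for l > 0 the two terms match after
   inserting [w * w^* = 1]. *)
rewrite qE; case: l {nw qE qE'} => [|l] /=; first by rewrite !mul0r; ring.
rewrite ![w^* ^+ l.+1]exprS.
transitivity (w^* * w^* ^+ l * fl * b1 *
  (w * w^* * q01 * x ^+ l.+1 + q00 * (l.+1%:R * x ^+ l * y))); first by ring.
transitivity (w^* * w^* ^+ l * fl * b1 *
  (w * w^* * q01 * x ^+ l.+1 + w * w^* * q00 * (l.+1%:R * x ^+ l * y))); last by ring.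
by rewrite ww; ring.
Qed.

(** * The operator on monomials *)

Definition psi_phi {R : realType} (psi phi : Cplx R -> Cplx R) (l : nat) :
  Cplx R -> Cplx R := fun z => psi z * phi z ^+ l.

Lemma gen_wcomp_monomial {R : realType} m (psi phi : Cplx R -> Cplx R) c n z :
  gen_wcomp m psi phi (monomial c n) z =
  psi z * (c * (n ^_ m)%:R * phi z ^+ (n - m)).
Proof. by rewrite /gen_wcomp derive1n_monomial. Qed.

Lemma gen_wcomp_monomial_lt {R : realType} m (psi phi : Cplx R -> Cplx R) c n z :
  (n < m)%N -> gen_wcomp m psi phi (monomial c n) z = 0.
Proof.
by move=> nm; rewrite gen_wcomp_monomial ffact_small// mulr0 mul0r mulr0.
Qed.

Lemma gen_wcomp_monomial_add {R : realType} m (psi phi : Cplx R -> Cplx R) c l z :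
  gen_wcomp m psi phi (monomial c (m + l)) z =
  c * ((m + l) ^_ m)%:R * psi_phi psi phi l z.
Proof. by rewrite gen_wcomp_monomial addKn /psi_phi mulrCA. Qed.

Lemma ffact_neq0 {R : realType} m l : ((m + l) ^_ m)%:R != 0 :> Cplx R.
Proof. by rewrite pnatr_eq0 -lt0n ffact_gt0 leq_addr. Qed.

(** * Matrix identities for a J_w-symmetric operator *)

Section Symmetric.
Variables (R : realType) (beta : nat -> R) (w : Cplx R) (m : nat).
Variables (phi psi : Cplx R -> Cplx R).
Hypothesis hbeta : forall n, 0 < beta n.
Hypothesis hw : `|w| = 1.
Let T := gen_wcomp m psi phi.
Hypothesis hbounded : bounded_operator beta T.
Variable S : (Cplx R -> Cplx R) -> (Cplx R -> Cplx R).
Hypothesis hS : is_adjoint beta T S.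
Hypothesis hTS : eq_op_H2 beta T (fun f => conjugation w (S (conjugation w f))).

Local Notation P := (psi_phi psi phi).
Local Notation p l := (taylor_coef (P l)).
Local Notation fall l := (((m + l) ^_ m)%:R : Cplx R).
Local Notation b n := (ofR (beta n)).

Lemma H2_psi_phi l : H2 beta (P l).
Proof.
have [HT _ _] := hbounded.
have -> : P l = T (monomial (fall l)^-1 (m + l)).
  by apply/funext => z; rewrite /T gen_wcomp_monomial_add mulVf ?mul1r// ffact_neq0.
exact/HT/H2_monomial.
Qed.

Lemma H2_T_monomial c n : H2 beta (T (monomial c n)).
Proof. by have [HT _ _] := hbounded; exact/HT/H2_monomial. Qed.

Lemma H2_S_monomial c n : H2 beta (S (monomial c n)).
Proof. by have [[HT _ _] _] := hS; exact/HT/H2_monomial. Qed.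

(** T = J_w S J_w is evaluated at conj(w)^n z^n, which J_w sends to z^n; the outer J_w is undone by
    applying J_w once more. *)
Lemma S_monomial n :
  eq_disc (S (monomial 1 n)) (conjugation w (T (monomial (w^* ^+ n) n))).
Proof.
move=> z zD; rewrite [RHS]/conjugation.
rewrite (hTS _ (H2_monomial _ _ _ _) _ (unit_disc_conjugate _ _ hw _ zD)).
rewrite /conjugation conjCK conjugate_conjugate//; congr (S _ z).
apply/funext => u; rewrite /monomial mul1r.
by rewrite rmorphM !rmorphXn /= rmorphM /= !conjCK -exprMn mulrA mul_conj1// mul1r.
Qed.

Lemma S_monomial_lt n z : (n < m)%N -> unit_disc z -> S (monomial 1 n) z = 0.
Proof.
by move=> nm zD; rewrite S_monomial// /conjugation /T gen_wcomp_monomial_lt ?conjC0.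
Qed.

Lemma S_monomial_add l z : unit_disc z -> S (monomial 1 (m + l)) z =
  w ^+ (m + l) * fall l * (P l (w * z^*))^*.
Proof.
move=> zD; rewrite S_monomial// /conjugation /T gen_wcomp_monomial_add.
by rewrite !rmorphM /= rmorphXn /= conjCK conjC_nat.
Qed.

Lemma taylor_coef_T k : taylor_coef (T (monomial 1 (m + k))) =1 (fun n => fall k * p k n).
Proof.
apply: taylor_coef_uniq; first exact: H2_T_monomial.
have -> : T (monomial 1 (m + k)) = fun z => fall k * P k z.
  by apply/funext => z; rewrite /T gen_wcomp_monomial_add mul1r.
exact: expands_off0Z (H2_expands _ _ _ (H2_psi_phi k)).
Qed.

Lemma taylor_coef_S l : taylor_coef (S (monomial 1 (m + l))) =1
  (fun n => w ^+ (m + l) * fall l * ((p l n)^* * w^* ^+ n)).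
Proof.
apply: taylor_coef_uniq; first exact: H2_S_monomial.
have H := expands_off0Z (w ^+ (m + l) * fall l) _ _
  (expands_off0_conjugation _ _ hw _ _ (H2_expands _ _ _ (H2_psi_phi l))).
move=> z zD z0; rewrite S_monomial_add//; exact: H.
Qed.

(** Stated for any adjoint [U], so that it applies to [S] and to the adjoint supplied by the
    Hermitian hypothesis. *)
Lemma adjoint_monomial {U : (Cplx R -> Cplx R) -> (Cplx R -> Cplx R)} j n :
  is_adjoint beta T U ->
  taylor_coef (T (monomial 1 j)) n * b n ^+ 2 =
  (taylor_coef (U (monomial 1 n)) j)^* * b j ^+ 2.
Proof.
move=> [_ TU]; have := TU (monomial 1 j) (monomial 1 n) (H2_monomial _ _ _ _) (H2_monomial _ _ _ _).
rewrite innerH2_monomial conjC1 mulr1 => ->.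
rewrite innerH2_conj innerH2_monomial conjC1 mulr1 rmorphM rmorphXn /=.
by rewrite (conj_Creal (ofR_real _)).
Qed.

Lemma weight_neq0 n : b n ^+ 2 != 0.
Proof. by rewrite expf_neq0// gt_eqF// ofR_gt0. Qed.

(** For j < m, T kills z^j and hence so does S, so row j of the matrix of T vanishes. *)
Lemma taylor_coef_psi_phi_lt k j : (j < m)%N -> p k j = 0.
Proof.
move=> jm; have := adjoint_monomial (m + k) j hS.
have -> : taylor_coef (S (monomial 1 j)) (m + k) = 0.
  (* [monomial 0 0] stands for the zero function. *)
  rewrite (eq_taylor_coef _ _ _ (monomial 0 0) (H2_S_monomial _ _) (H2_monomial _ _ _ _)).
    by rewrite taylor_coef_monomial if_same.
  by move=> z zD _; rewrite S_monomial_lt// /monomial mul0r.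
rewrite conjC0 mul0r taylor_coef_T => /eqP.
by rewrite mulf_eq0 (negbTE (weight_neq0 _)) orbF mulf_eq0 (negbTE (ffact_neq0 _ _)) => /eqP.
Qed.

(** The entry of T is compared with that of S = J_w T J_w; the factors w^m and conj(w)^m cancel. *)
Lemma taylor_coef_psi_phi_sym k l :
  fall k * p k (m + l)%N * b (m + l) ^+ 2 * w ^+ l =
  fall l * p l (m + k)%N * b (m + k) ^+ 2 * w ^+ k.
Proof.
have := adjoint_monomial (m + k) (m + l) hS.
rewrite taylor_coef_T taylor_coef_S => ->.
move: (taylor_coef _ _) => x.
rewrite !rmorphM !rmorphXn /= !conjCK conjC_nat.
have -> : w ^+ (m + k) = w ^+ m * w ^+ k by rewrite exprD.
have -> : w^* ^+ (m + l) = w^* ^+ m * w^* ^+ l by rewrite exprD.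
have e n : w^* ^+ n * w ^+ n = 1 by rewrite -exprMn mulrC mul_conj1// expr1n.
transitivity (fall l * x * b (m + k) ^+ 2 * w ^+ k *
   (w^* ^+ m * w ^+ m) * (w^* ^+ l * w ^+ l)); first by ring.
by rewrite !e !mulr1.
Qed.

(** * Leading coefficients and the necessity of the conditions *)

Hypothesis hphi : derivable phi 0 1.
Hypothesis hpsi0 : exists z, unit_disc z /\ psi z <> 0.

Local Notation q l i := (p l (m + i)%N).

Lemma expands_psi_phi_shifted l :
  expands_off0 (fun z => P l z / z ^+ m) (fun i => q l i).
Proof.
apply: expands_off0_drop; first exact: H2_expands _ _ _ (H2_psi_phi l).
exact: taylor_coef_psi_phi_lt.
Qed.

(** [expands_off0_mul] is applied to P_0 / z^m and g = phi^l. *)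
Lemma psi_phi_low_coefs l :
  q l 0%N = q 0%N 0%N * phi 0 ^+ l /\
  q l 1%N = q 0%N 1%N * phi 0 ^+ l
            + q 0%N 0%N * (l%:R * phi 0 ^+ l.-1 * derive1 phi 0).
Proof.
have [dl <-] := derive1_exprn phi 0 l hphi.
apply: (expands_off0_mul (expands_psi_phi_shifted 0) (expands_psi_phi_shifted l) dl).
by move=> z _ _; rewrite /psi_phi expr0 mulr1 mulrAC.
Qed.

Lemma rot_neq0 n : w ^+ n != 0.
Proof. by rewrite expf_neq0// -normr_eq0 hw oner_neq0. Qed.

(** If q_(0,0) = 0, then q_(l,0) = q_(0,0) phi(0)^l = 0 for all l, and the symmetry relation with k
    = 0 makes every Taylor coefficient of psi vanish. *)
Lemma psi_lead_neq0 : q 0%N 0%N != 0.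
Proof.
apply/negP => /eqP q00; have [z [zD]] := hpsi0; apply.
have p0 j : p 0%N j = 0.
  have [|mj] := ltnP j m; first exact: taylor_coef_psi_phi_lt.
  rewrite -(subnKC mj); have := taylor_coef_psi_phi_sym 0 (j - m).
  have [-> _] := psi_phi_low_coefs (j - m).
  rewrite q00 mul0r mulr0 !mul0r => /eqP.
  rewrite mulf_eq0 (negbTE (rot_neq0 _)) orbF.
  rewrite mulf_eq0 (negbTE (weight_neq0 _)) orbF mulf_eq0.
  by rewrite (negbTE (ffact_neq0 _ _)) => /eqP.
have [_ /(_ z zD) psiE _] := H2_psi_phi 0.
have u0 j : j != 0%N -> p 0%N j * z ^+ j = 0 by rewrite p0 mul0r.
have : P 0%N z = p 0%N 0%N * z ^+ 0.
  apply: (cvg_unique (@norm_hausdorff _ _) psiE).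
  exact: (cvg_series1 (fun n => p 0%N n * z ^+ n : Cplx R) 0 u0).
by rewrite p0 mul0r /psi_phi expr0 mulr1.
Qed.

Lemma leading_coefs_real U : is_adjoint beta T U -> eq_op_H2 beta T U ->
  [/\ q 0%N 0%N \is Num.real, derive1 phi 0 \is Num.real
    & (phi 0)^* = w^* * phi 0].
Proof.
move=> hU hTU.
(* [adjoint_monomial] for [U], whose values on monomials are those of T. *)
have herm k l : fall k * q k l * b (m + l) ^+ 2 =
    fall l * (q l k)^* * b (m + k) ^+ 2.
  have := adjoint_monomial (m + k) (m + l) hU.
  have -> : taylor_coef (U (monomial 1 (m + l))) (m + k) =
      taylor_coef (T (monomial 1 (m + l))) (m + k).
    apply: (eq_taylor_coef _ beta).
    - by have [[HU _ _] _] := hU; exact/HU/H2_monomial.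
    - exact: H2_T_monomial.
    - by move=> z zD _; rewrite (hTU _ (H2_monomial _ _ _ _) z zD).
  by rewrite !taylor_coef_T rmorphM /= conjC_nat.
have [q10 q11] := psi_phi_low_coefs 1; rewrite expr1 mul1r expr0 mul1r in q10 q11.
have s01 := taylor_coef_psi_phi_sym 0 1; rewrite expr0 mulr1 expr1 in s01.
apply: (hermitian_coefs_real (mul_conj1 _ _ hw) _ _ psi_lead_neq0 q10 q11 s01
  (herm 0%N 0%N) (herm 0%N 1%N) (herm 1%N 1%N)).
  by split; rewrite ?realn ?rpredX ?ofR_real.
by split; rewrite ?ffact_neq0 ?weight_neq0.
Qed.

(** * Sufficiency of the conditions *)

Hypothesis hq0 : q 0%N 0%N \is Num.real.
Hypothesis hphi1 : derive1 phi 0 \is Num.real.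
Hypothesis hphi0 : (phi 0)^* = w^* * phi 0.

Lemma conj_coef0 l : (q 0%N l)^* = w ^+ l * q 0%N l.
Proof.
have [q0 _] := psi_phi_low_coefs l.
have := taylor_coef_psi_phi_sym 0 l; rewrite expr0 mulr1 q0 => s0.
apply: (conj_first_coef l (mul_conj1 _ _ hw) _ _ _ hq0 hphi0 s0).
- by split; rewrite ?realn ?rpredX ?ofR_real.
- exact: ffact_neq0.
- exact: weight_neq0.
Qed.

Lemma conj_coef1 l : (q 1%N l)^* = w^* * w ^+ l * q 1%N l.
Proof.
have [_ q1] := psi_phi_low_coefs l.
have := taylor_coef_psi_phi_sym 1 l; rewrite expr1 q1 => s1.
(* Column 1 involves q_(0,1), whose conjugate is known from column 0. *)
have c01 := conj_coef0 1; rewrite expr1 in c01.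
apply: (conj_second_coef l (mul_conj1 _ _ hw) _ _ _ hq0 hphi1 hphi0 c01 s1).
- by split; rewrite ?realn ?rpredX ?ofR_real.
- exact: ffact_neq0.
- exact: weight_neq0.
Qed.

(** Both sides have expansions with equal coefficients: those below m vanish, and at n = m + i the
    factor w^i cancels against conj(w)^n, leaving conj(w)^m. *)
Lemma conj_psi_phi_of_coefs l : (forall i, (q l i)^* = w^* ^+ l * w ^+ i * q l i) ->
  forall z, unit_disc z -> z != 0 ->
    (P l (w * z^*))^* = w^* ^+ (m + l) * P l z.
Proof.
move=> ql z zD z0.
have PE := H2_expands _ _ _ (H2_psi_phi l).
have E1 := expands_off0_conjugation _ _ hw _ _ PE.
have E2 := expands_off0Z (w^* ^+ (m + l)) _ _ PE.
have aE : (fun n => w^* ^+ (m + l) * p l n) = (fun n => (p l n)^* * w^* ^+ n).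
  apply/funext => n; have [nm|mn] := ltnP n m.
    by rewrite taylor_coef_psi_phi_lt// conjC0 mulr0 mul0r.
  have ww : w ^+ (n - m) * w^* ^+ (n - m) = 1.
    by rewrite -exprMn mul_conj1// expr1n.
  have := ql (n - m)%N; rewrite subnKC// => ->.
  rewrite -[in RHS](subnKC mn) [X in _ = _ * X]exprD subnKC//.
  transitivity (w^* ^+ l * w^* ^+ m * p l n * (w ^+ (n - m) * w^* ^+ (n - m))).
    by rewrite ww exprD; ring.
  by ring.
rewrite aE in E2.
exact: (cvg_unique (@norm_hausdorff _ _) (E1 _ zD z0) (E2 _ zD z0)).
Qed.

Lemma conj_psi_phi l z : unit_disc z -> z != 0 ->
  (P l (w * z^*))^* = w^* ^+ (m + l) * P l z.
Proof.
move=> zD z0.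
have := conj_psi_phi_of_coefs 0 _ z zD z0.
rewrite /psi_phi !expr0 !mulr1 addn0 => /(_ _) psiw.
have {}psiw : (psi (w * z^*))^* = w^* ^+ m * psi z.
  by apply: psiw => i; rewrite mul1r; exact: conj_coef0.
have : (psi (w * z^*) * phi (w * z^*))^* = w^* ^+ (m + 1) * (psi z * phi z).
  by apply: (conj_psi_phi_of_coefs 1 _ z zD z0) => i; rewrite expr1; exact: conj_coef1.
rewrite !rmorphM rmorphXn /= psiw exprD expr1 => phiw.
(* After rewriting with [psiw] both sides contain the factor [psi z]; where it is nonzero, dividing
   [phiw] by it isolates phi. *)
have [->|psiz] := eqVneq (psi z) 0; first by rewrite mul0r !mulr0 mul0r.
have nw : w^* ^+ m != 0 by rewrite -rmorphXn conjC_eq0 rot_neq0.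
have -> : (phi (w * z^*))^* = w^* * phi z.
  by apply: (mulfI nw); apply: (mulfI psiz); rewrite mulrA [psi z * _]mulrC phiw; ring.
by rewrite exprD exprMn; ring.
Qed.

Lemma taylor_coef_S_T n :
  taylor_coef (S (monomial 1 n)) =1 taylor_coef (T (monomial 1 n)).
Proof.
apply: eq_taylor_coef; [exact: H2_S_monomial|exact: H2_T_monomial|] => z zD z0.
have [nm|mn] := ltnP n m.
  by rewrite S_monomial_lt// /T gen_wcomp_monomial_lt.
rewrite -(subnKC mn) S_monomial_add// conj_psi_phi// /T gen_wcomp_monomial_add mul1r.
rewrite mulrA; congr (_ * _).
by rewrite mulrAC -exprMn mul_conj1// expr1n mul1r.
Qed.

(** Against e = z^j, (T f, e) = (f, S e) = (f, T e) = conj (T e, f) = conj (e, S f) = (S f, e), so T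
    f and S f have the same coefficients. *)
Lemma S_eq_T : eq_op_H2 beta T S.
Proof.
move=> f Hf; have [[HS _ _] adj] := hS; have [HT _ _] := hbounded.
apply: (H2_eq_disc _ beta) => [||j]; [exact: HT|exact: HS|].
apply: (mulIf (weight_neq0 j)).
have E g : innerH2 beta g (monomial 1 j) = taylor_coef g j * b j ^+ 2.
  by rewrite innerH2_monomial conjC1 mulr1.
have Hj := H2_monomial R beta 1 j.
rewrite -(E (T f)) -(E (S f)) (adj _ _ Hf Hj) (eq_innerH2 _ _ _ _ _ (taylor_coef_S_T j)).
by rewrite innerH2_conj (adj _ _ Hj Hf) -innerH2_conj.
Qed.

End Symmetric.

Theorem theorem3 (R : realType) (beta : nat -> R) (w : Cplx R) (m : nat)
    (phi psi : Cplx R -> Cplx R)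
    (hbeta : weight beta)
    (hw : `|w| = 1)
    (hphi : analytic_self_map phi)
    (hpsi : holomorphic psi)
    (hpsi0 : exists z, unit_disc z /\ psi z <> 0)
    (hbounded : bounded_operator beta (gen_wcomp m psi phi))
    (hsym : J_symmetric beta w (gen_wcomp m psi phi)) :
  hermitian_operator beta (gen_wcomp m psi phi) <->
  [/\ derive1n m psi 0 \is Num.real,
      derive1 phi 0 \is Num.real
    & (phi 0)^* = w^* * phi 0].
Proof.
have [beta_gt0 _ _] := hbeta; have [S [hS hTS]] := hsym.
have dphi : derivable phi 0 1 by apply: hphi.1; rewrite /unit_disc /= normr0.
have psiE : psi_phi psi phi 0 = psi by apply/funext => z; rewrite /psi_phi expr0 mulr1.
(* P_0 is psi, and its coefficient m is psi^(m)(0) divided by the real number m!. *)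
have q0E : (taylor_coef (psi_phi psi phi 0) (m + 0) \is Num.real) =
    (derive1n m psi 0 \is Num.real).
  have f0 : m`!%:R != 0 :> Cplx R by rewrite pnatr_eq0 -lt0n fact_gt0.
  rewrite psiE addn0 -(divfK f0 (derive1n m psi 0)).
  apply/idP/idP => h; first by rewrite rpredM ?realn.
  by rewrite -[taylor_coef _ _](mulfK f0) rpred_div ?realn.
split=> [[U [hU hTU]]|[psim phi1 phi0]].
  have [] := leading_coefs_real _ _ _ _ _ _ beta_gt0 hw hbounded _ hS hTS dphi hpsi0 _ hU hTU.
  by rewrite q0E.
exists S; split=> //; rewrite -q0E in psim.
exact: (S_eq_T _ _ _ _ _ _ beta_gt0 hw hbounded _ hS hTS dphi psim phi1 phi0).
Qed.
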